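(* Let $(X,\succcurlyeq^X)$ and $(Y,\succcurlyeq^Y)$ be partially ordered Banach spaces, let $(U,\succcurlyeq^U)$ be a poset, and let $C\subseteq X$ and $D\subseteq Y$ be nonempty weakly compact subsets. Let $T:C\times D\to U$ be a single-valued mapping, let $F:C\to 2^D\setminus\{\emptyset\}$ and $G:D\to 2^C\setminus\{\emptyset\}$ be set-valued mappings, and let $\varphi:C\to 2^D\setminus\{\emptyset\}$ and $\psi:D\to 2^C\setminus\{\emptyset\}$ be the order-optimization mappings of $(T,F,G)$ (all their values being nonempty). Suppose that $\varphi$ and $\psi$ are both order-increasing upward with closed values in $D$ and $C$, respectively. If there are $(x',y')\in C\times D$, $u'\in\varphi(x')$ and $z'\in\psi(y')$ such that $$x'\preccurlyeq^X z'\quad\text{and}\quad y'\preccurlyeq^Y u',$$ then the solution set $\mathcal S(T,F,G)$ of $\mathrm{ROEP}(T,F,G)$ is nonempty and inductive in $(C\times D,\succcurlyeq^{X\times Y})$, and $\mathrm{ROEP}(T,F,G)$ has an $\succcurlyeq^{X\times Y}$-maximal solution (i.e. $\mathcal S(T,F,G)$ has a maximal element).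
   Context: A partially ordered Banach space $(X,\succcurlyeq^X)$ is here a Banach space with the partial order induced by a closed convex cone $K_X\subseteq X$: $x\succcurlyeq^X y$ iff $x-y\in K_X$ (similarly $(Y,\succcurlyeq^Y)$ with a closed convex cone $K_Y$). For a partial order $\succcurlyeq$, $a\succ b$ means $a\succcurlyeq b$ and $a\ne b$; $\not\succ$ is its negation; $a \preccurlyeq b$ means $b\succcurlyeq a$. A point $a$ of a subset $A$ of a poset is $\succcurlyeq$-maximal (resp. $\succcurlyeq$-minimal) in $A$ if no $b\in A$ satisfies $b\succ a$ (resp. $a\succ b$). $\mathrm{ROEP}(T,F,G)$ is the problem of finding $x^*\in C$, $y^*\in D$ with $x^*\in G(y^* )$ and $y^*\in F(x^* )$ such that $T(x,y^* )\not\succ^U T(x^*,y^* )\not\succ^U T(x^*,y)$ for all $x\in G(y^* )$ and $y\in F(x^* )$. Such $(x^*,y^* )\in C\times D$ is a solution; $\mathcal S(T,F,G)$ is the set of all solutions. Order-optimization mappings: for $x\in C$, $\varphi(x)=\{z\in F(x): T(x,z)\text{ is an }\succcurlyeq^U\text{-minimal point of } T(x,F(x))\}$; for $y\in D$, $\psi(y)=\{u\in G(y): T(u,y)\text{ is an }\succcurlyeq^U\text{-maximal point of } T(G(y),y)\}$. Here $T(x,F(x))=\{T(x,z):z\in F(x)\}$ and $T(G(y),y)=\{T(u,y):u\in G(y)\}$. $\succcurlyeq^{X\times Y}$ is the componentwise order on $C\times D$: $(x_1,y_1)\preccurlyeq^{X\times Y}(x_2,y_2)$ iff $x_1\preccurlyeq^X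 x_2$ and $y_1\preccurlyeq^Y y_2$. A set-valued mapping $H:P\to 2^Q\setminus\{\emptyset\}$ between posets is order-increasing upward if $p_1\preccurlyeq p_2$ in $P$ and $q_1\in H(p_1)$ imply that there is $q_2\in H(p_2)$ with $q_1\preccurlyeq q_2$. A subset $A$ of a poset is inductive if every chain in $A$ has an upper bound in $A$.
   Formalization: ''Closed values in D and C'' is taken to mean closed in the relative weak topology of D and C; with norm-closed values the claim fails (in l^2 ordered by the cone of nonpositive partial sums, the unit vectors form a chain of solutions with no maximal element). *)

(* Defs.v *)
From HB Require Import structures.
From mathcomp Require Import all_boot all_order all_algebra.
From mathcomp Require Import all_classical all_reals all_analysis.

Set Implicit Arguments.
Unset Strict Implicit.
Unset Printing Implicit Defensive.

Import Order.TTheory GRing.Theory Num.Theory.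
Import numFieldNormedType.Exports.

Local Open Scope classical_set_scope.
Local Open Scope ring_scope.

(* A copy of X carrying the coarsest topology for which every norm-continuous
   linear functional is continuous. *)
Definition weak_space (R : realType) (X : normedModType R) : Type :=
  sup_topology (fun f : {f : {linear X -> R^o} | continuous f} =>
    Topological.class (initial_topology (sval f))).

HB.instance Definition _ (R : realType) (X : normedModType R) :=
  Topological.on (weak_space X).

Definition weakly_compact (R : realType) (X : normedModType R) (A : set X) :=
  compact (A : set (weak_space X)).

(* "Closed in D", for a weakly compact D, refers to the topology in which D is
   compact, i.e. the one D inherits from the weak topology. It cannot be
   weakened to the norm topology in the theorem on reciprocal order-equilibria:
   in l^2 ordered by the cone of sequences whose partial sums are all <= 0, the
   unit vectors e_n form a norm-closed, strictly increasing chain inside the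
   weakly compact set {0} U {e_n : n}, and the chain has no maximal element. *)
Definition weakly_closed_in (R : realType) (X : normedModType R)
    (D A : set X) :=
  closed (A : set (@subspace (weak_space X) D)).

(* The last clause says that the relation induced by K is antisymmetric. *)
Definition ordering_cone (R : realType) (X : normedModType R) (K : set X) :=
  [/\ closed K,
      convex_set (K : set (convex_lmodType X)),
      K 0,
      (forall (t : R) x, 0 <= t -> K x -> K (t *: x))
    & (forall x, K x -> K (- x) -> x = 0)].

Definition cone_le (R : realType) (X : normedModType R) (K : set X)
    (x y : X) : Prop :=
  K (y - x).

Definition prod_le (P Q : Type) (leP : P -> P -> Prop) (leQ : Q -> Q -> Prop)
    (a b : P * Q) : Prop :=
  leP a.1 b.1 /\ leQ a.2 b.2.

Definition strictly (P : Type) (le : P -> P -> Prop) (a b : P) : Prop :=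
  le a b /\ a <> b.

Definition maximal_in (P : Type) (le : P -> P -> Prop) (A : set P) (a : P) :=
  A a /\ forall b, A b -> ~ strictly le a b.

Definition minimal_in (P : Type) (le : P -> P -> Prop) (A : set P) (a : P) :=
  A a /\ forall b, A b -> ~ strictly le b a.

Definition inductive_set (P : Type) (le : P -> P -> Prop) (A : set P) :=
  forall B : set P, B `<=` A -> total_on B le ->
    exists2 u, A u & forall b, B b -> le b u.

(* H restricts to a mapping A -> 2^B \ {0}; its values outside A are junk. *)
Definition setvalued_map (P Q : Type) (A : set P) (B : set Q)
    (H : P -> set Q) :=
  forall p, A p -> H p !=set0 /\ H p `<=` B.

Definition order_increasing_upward (P Q : Type) (leP : P -> P -> Prop)
    (leQ : Q -> Q -> Prop) (A : set P) (H : P -> set Q) :=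
  forall p1 p2 q1, A p1 -> A p2 -> leP p1 p2 -> H p1 q1 ->
    exists2 q2, H p2 q2 & leQ q1 q2.

Section roep.
Context {X Y : Type} {disp : Order.disp_t} {U : porderType disp}.
Variables (T : X -> Y -> U) (F : X -> set Y) (G : Y -> set X).

Definition roep_phi (x : X) : set Y :=
  [set z | F x z /\
    minimal_in (fun a b : U => (a <= b)%O) [set T x z' | z' in F x] (T x z)].

Definition roep_psi (y : Y) : set X :=
  [set u | G y u /\
    maximal_in (fun a b : U => (a <= b)%O) [set T u' y | u' in G y] (T u y)].

Definition roep_solutions (C : set X) (D : set Y) : set (X * Y) :=
  [set s | [/\ C s.1, D s.2, G s.2 s.1, F s.1 s.2 &
    forall x y, G s.2 x -> F s.1 y ->
      ~ (T s.1 s.2 < T x s.2)%O /\ ~ (T s.1 y < T s.1 s.2)%O]].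

End roep.

(* Main.v *)
Require Import Defs.
From HB Require Import structures.
From mathcomp Require Import all_boot all_order all_algebra.
From mathcomp Require Import all_classical all_reals all_analysis.
From mathcomp Require Import lra.

Set Implicit Arguments.
Unset Strict Implicit.
Unset Printing Implicit Defensive.

Import Order.TTheory GRing.Theory Num.Theory.
Import numFieldNormedType.Exports.

Local Open Scope classical_set_scope.
Local Open Scope ring_scope.

(** Being a solution means that each player's strategy is an optimal answer to
    the other's: (x, y) solves the equilibrium problem iff x lies in psi y and
    y lies in phi x.  So solutions are the fixed points of the set-valued map
    H (x, y) = psi y * phi x on C * D, and H is order-increasing upward.

    As in Tarski-type theorems, consider the ascending points: those p with
    p <= q for some q in H p.  The starting data say that (x', y') is
    ascending, and every fixed point is ascending.  If p is ascending, with
    p <= q and q in H p, then q is ascending too because H is increasing; so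
    an ascending point that is maximal among the ascending points equals q and
    is a fixed point.  By Zorn's lemma it remains to bound chains of ascending
    points.  Let B be such a chain and u its supremum in C * D.  Each b in B
    lies below some point of H b, hence, as b <= u and H is increasing, below
    some point of H u.  If a single q in H u lies above all of B, then u <= q
    because u is the supremum, so u is ascending.  Applied above a given
    ascending point, the argument produces a maximal fixed point there
    ([ascending_below_fixed]); applied above the bound of a chain of fixed
    points, it shows that the set of fixed points is inductive
    ([increasing_fixed_points]).

    Both compactness facts, the existence of u and that of q, are
    instances of one property, [chain_closed].  It holds for a closed part of
    a compact set as soon as the sections {x | b <= x} are closed, since a
    cluster point of the nonempty closed sets that {x | b <= x}, b in B, cut
    out of that part lies in all of them ([compact_chain_closed]).  The
    supremum is obtained by applying the property to the closed set of points
    below all the upper bounds of B.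

    The topology is the weak one, so the order intervals have to be weakly
    closed.  This is where the Hahn-Banach theorem enters: a closed convex cone
    is an intersection of half-spaces given by continuous linear functionals
    ([cone_separation], [weak_closed_sections]).  The Hahn-Banach theorem is
    derived from the fact that a minimal sublinear functional is linear. *)

(** * Zorn's lemma for a set in a poset *)

Definition partial_order (P : Type) (le : P -> P -> Prop) :=
  [/\ forall a, le a a,
      forall b a c, le a b -> le b c -> le a c
    & forall a b, le a b -> le b a -> a = b].

(** Only nonempty chains need a bound: the starting point [a] bounds the empty
    one. *)
Lemma Zorn_above (P : Type) (le : P -> P -> Prop) (A : set P) (a : P) :
    partial_order le ->
    (forall B, B !=set0 -> B `<=` A -> total_on B le ->
      exists2 u, A u & forall b, B b -> le b u) ->
    A a -> exists2 m, maximal_in le A m & le a m.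
Proof.
move=> [lexx letr leanti] chA Aa.
pose Q := {p : P | A p /\ le a p}.
pose a0 : Q := exist _ a (conj Aa (lexx a)).
have [||||m mmax] := @Zorn Q (fun s t => `[< le (sval s) (sval t) >]).
- by move=> s; apply/asboolP.
- by move=> r s t /asboolP rs /asboolP st; apply/asboolP; exact: letr rs st.
- move=> [s sP] [t tP] /asboolP/= st /asboolP/= ts.
  by apply: eq_exist; exact: leanti.
- move=> B Btot; have [[b0 Bb0]|B0] := pselect (B !=set0); last first.
    by exists a0 => s Bs; case: B0; exists s.
  have [||p q|u Au uB] := chA [set sval q | q in B].
  + by exists (sval b0); exists b0.
  + by move=> _ [q _ <-]; case: (svalP q).
  + move=> [p' Bp <-] [q' Bq <-].
    by case: (Btot _ _ Bp Bq) => /asboolP; [left|right].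
  have au : le a u.
    by apply: letr (uB (sval b0) _); [case: (svalP b0)|exists b0].
  exists (exist _ u (conj Au au)) => s Bs; apply/asboolP => /=.
  by apply: uB; exists s.
have [Am am] := svalP m.
exists (sval m) => //; split=> // b Ab [mb neq]; apply: neq.
have ab := letr _ _ _ am mb.
have := mmax (exist _ b (conj Ab ab)).
by move=> /(_ (asboolT mb)) <-.
Qed.

(** * Sublinear functionals and the Hahn-Banach theorem *)

Section hahn_banach.
Variables (R : realType) (V : lmodType R).
Implicit Types (q : V -> R) (S : set (V * R)).

Definition sublinear q :=
  (forall u v, q (u + v) <= q u + q v) /\
  (forall t v, 0 <= t -> q (t *: v) <= t * q v).

(** [S] prescribes the lower bounds [s.2 <= f s.1] for a functional [f]; the
    prescriptions form a convex cone compatible with the bound [q]. *)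
Definition dominated_cone q S :=
  [/\ S (0, 0),
      forall s s', S s -> S s' -> S (s + s'),
      forall t s, 0 <= t -> S s -> S (t *: s.1, t * s.2)
    & forall s, S s -> s.2 <= q s.1].

Lemma sublinearN_ge q v : sublinear q -> - q (- v) <= q v.
Proof.
move=> [qD qZ]; have := qD v (- v); rewrite subrr.
have := qD 0 0; rewrite addr0; lra.
Qed.

Lemma sublinearZ q t v : sublinear q -> 0 <= t -> q (t *: v) = t * q v.
Proof.
move=> sq t0; have [_ qZ] := sq; apply/eqP; rewrite eq_le qZ//=.
move: t0; rewrite le0r => /orP[/eqP->|t0].
  rewrite scale0r mul0r; have := sublinearN_ge 0 sq; rewrite oppr0; lra.
rewrite -ler_pdivlMl//; have := qZ t^-1 (t *: v).
by rewrite scalerA mulVf ?gt_eqF// scale1r invr_ge0; apply; exact: ltW.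
Qed.

(** The functional q' v = inf (q (v + s) - r) over the pairs (s, r) of [S] is
    sublinear because [S] is a convex cone, and finite because [q] dominates
    [S].  Any linear f <= q' satisfies f (- s) <= - r, that is r <= f s: the
    prescriptions of [S] have been built into the upper bound. *)
Lemma sublinear_lower q S : sublinear q -> dominated_cone q S ->
  exists q', [/\ sublinear q', forall v, q' v <= q v
               & forall s, S s -> q' (- s.1) <= - s.2].
Proof.
move=> sq [S0 SD SZ Sq]; have [qD qZ] := sq.
pose E v := [set q (v + s.1) - s.2 | s in S].
have E0 v : E v !=set0 by exists (q (v + 0) - 0); exists (0, 0).
have Elb v : has_lbound (E v).
  exists (- q (- v)) => _ [s Ss <-]; have := Sq s Ss.
  by have := qD (- v) (v + s.1); rewrite addKr; lra.
have lb v s : S s -> inf (E v) <= q (v + s.1) - s.2.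
  by move=> Ss; apply: ge_inf => //; exists s.
have glb v x : (forall s, S s -> x <= q (v + s.1) - s.2) -> x <= inf (E v).
  by move=> h; apply: lb_le_inf => // _ [s Ss <-]; exact: h.
exists (fun v => inf (E v)); split.
- split=> [u v|t v].
    rewrite -lerBlDr; apply: (glb _ _) => s Ss.
    rewrite lerBlDr [leRHS]addrC -lerBlDr.
    apply: (glb _ _) => s' Ss'.
    rewrite lerBlDr; have := lb (u + v) _ (SD _ _ Ss Ss').
    by have := qD (u + s.1) (v + s'.1); rewrite addrACA /=; lra.
  rewrite le0r => /orP[/eqP->|t0].
    rewrite scale0r mul0r; apply: le_trans (lb 0 _ S0) _ => /=.
    by rewrite addr0 subr0; have := qZ 0 0 (lexx _); rewrite scale0r mul0r.
  rewrite -ler_pdivrMl//; apply: (glb _ _) => s Ss; rewrite ler_pdivrMl//.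
  apply: le_trans (lb _ _ (SZ t s (ltW t0) Ss)) _ => /=.
  by rewrite -scalerDr mulrBr lerB// qZ// ltW.
- by move=> v; apply: le_trans (lb v _ S0) _; rewrite /= addr0 subr0.
- move=> s Ss; apply: le_trans (lb _ _ Ss) _.
  rewrite addNr; have := qZ 0 0 (lexx _); rewrite scale0r; lra.
Qed.

(** Zorn's lemma for the reversed pointwise order: the pointwise infimum of a
    chain of sublinear functionals is sublinear, and it is finite because
    b0 v >= - b0 (- v) passes to the smaller functionals of the chain. *)
Lemma minimal_sublinear q : sublinear q ->
  exists m, [/\ sublinear m, forall v, m v <= q v
    & forall q', sublinear q' -> (forall v, q' v <= m v) -> q' = m].
Proof.
pose ge (g h : V -> R) := forall v, h v <= g v.
have po : partial_order ge.
  split=> [g v|h g k gh hk v|g h gh hg]; first exact: lexx.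
    exact: le_trans (hk v) (gh v).
  by apply/funext => v; apply/eqP; rewrite eq_le gh hg.
move=> sq; have [B [b0 Bb0] Bsub Btot|m [sm mmin] mq] := Zorn_above po _ sq.
  pose E v := [set b v | b in B].
  have E0 v : E v !=set0 by exists (b0 v); exists b0.
  (* If b <= b0, compare the two at [- v]; if b0 <= b, compare them at [v]. *)
  have blb b v : B b -> - b0 (- v) <= b v.
    move=> Bb; have := sublinearN_ge v (Bsub _ Bb).
    have := sublinearN_ge v (Bsub _ Bb0).
    by case: (Btot _ _ Bb0 Bb) => h; have := h v; have := h (- v); lra.
  have lb b v : B b -> inf (E v) <= b v.
    move=> Bb; apply: ge_inf; last by exists b.
    by exists (- b0 (- v)) => _ [c Bc <-]; exact: blb.
  have glb v x : (forall b, B b -> x <= b v) -> x <= inf (E v).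
    by move=> h; apply: lb_le_inf => // _ [b Bb <-]; exact: h.
  exists (fun v => inf (E v)); last by move=> b Bb v; exact: lb.
  split=> [u v|t v].
    rewrite -lerBlDr; apply: (glb _ _) => b Bb.
    rewrite lerBlDr [leRHS]addrC -lerBlDr; apply: (glb _ _) => c Bc.
    rewrite lerBlDr.
    have := lb _ (u + v) Bb; have := lb _ (u + v) Bc.
    have := (Bsub _ Bb).1 u v; have := (Bsub _ Bc).1 u v.
    by case: (Btot _ _ Bb Bc) => h; have := h v; have := h u; lra.
  rewrite le0r => /orP[/eqP->|t0].
    rewrite scale0r mul0r; apply: le_trans (lb _ 0 Bb0) _.
    by have := (Bsub _ Bb0).2 0 0 (lexx _); rewrite scale0r mul0r.
  rewrite -ler_pdivrMl//; apply: (glb _ _) => b Bb; rewrite ler_pdivrMl//.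
  by apply: le_trans (lb _ _ Bb) _; exact/(Bsub _ Bb).2/ltW.
exists m; split=> // q' sq' q'm.
by apply: contrapT => ne; apply: (mmin q' sq'); split=> // /esym.
Qed.

(** A minimal sublinear functional [m] is linear: lowering [m] along the ray
    through (y, m y) with [sublinear_lower] cannot change it, whence
    m (- y) <= - m y, so [m] is odd, and an odd subadditive functional is
    additive. *)
Lemma Hahn_Banach_cone q S : sublinear q -> dominated_cone q S ->
  exists f : {linear V -> R^o},
    (forall v, f v <= q v) /\ (forall s, S s -> s.2 <= f s.1).
Proof.
move=> sq dS; have [q' [sq' q'q q'S]] := sublinear_lower sq dS.
have [m [[mD mZ] mq' mmin]] := minimal_sublinear sq'.
have mN y : m (- y) = - m y.
  apply/eqP; rewrite eq_le; apply/andP; split; last first.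
    by have := @sublinearN_ge m (- y) (conj mD mZ); rewrite opprK.
  have [|q'' [sq'' /(mmin _ sq'')-> h]] := @sublinear_lower m
      [set s | exists2 t, 0 <= t & s = (t *: y, t * m y)] (conj mD mZ).
    split.
    - by exists 0; rewrite // scale0r mul0r.
    - move=> _ _ [t t0 ->] [t' t0' ->]; exists (t + t'); first exact: addr_ge0.
      by rewrite scalerDl mulrDl.
    - move=> a _ a0 [t t0 ->]; exists (a * t); first exact: mulr_ge0.
      by rewrite scalerA mulrA.
    - by move=> _ [t t0 ->] /=; rewrite sublinearZ.
  by apply: (h (y, m y)); exists 1; rewrite ?scale1r ?mul1r.
have mDE u v : m (u + v) = m u + m v.
  apply/eqP; rewrite eq_le mD /=.
  by have := mD (u + v) (- v); rewrite addrK mN lerBrDr.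
have mlin : linear (m : V -> R^o).
  move=> t u v; rewrite mDE; congr (_ + _).
  have [t0|/ltW t0] := leP 0 t; first by rewrite sublinearZ.
  by rewrite -[LHS]opprK -mN -scaleNr sublinearZ ?oppr_ge0// mulNr opprK.
pose f := GRing.isLinear.Build R V R^o *:%R (m : V -> R^o) mlin.
pose F : {linear V -> R^o} := HB.pack (m : V -> R^o) f.
exists F; split=> [v|s Ss]; first exact: le_trans (mq' v) (q'q v).
rewrite -[X in X <= _]opprK -[X in _ <= X]opprK -mN lerN2.
exact: le_trans (mq' _) (q'S s Ss).
Qed.

End hahn_banach.

(** * Weak closedness of order intervals *)

(** If the ball of radius [d] around [x0] misses [K], then the prescriptions
    0 <= f on [K] and d <= f (- x0) generate a cone dominated by the norm. *)
Lemma cone_separation (R : realType) (X : normedModType R) (K : set X)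
    (x0 : X) : closed K -> K 0 -> (forall x y, K x -> K y -> K (x + y)) ->
    (forall (t : R) x, 0 <= t -> K x -> K (t *: x)) -> ~ K x0 ->
  exists f : {linear X -> R^o},
    [/\ continuous f, forall k, K k -> 0 <= f k & f x0 < 0].
Proof.
move=> clK K0 KD KZ nKx0.
have [d d0 dK] : exists2 d : R, 0 < d & forall k, K k -> d <= `|k - x0|.
  have : nbhs x0 (~` K) by apply: open_nbhs_nbhs; split; [exact: closed_openC|].
  rewrite -nbhs_ballE => -[d /= d0 dK]; exists d => // k Kk.
  rewrite leNgt; apply/negP => kd; apply: (dK k) => //.
  by rewrite -ball_normE /= distrC.
have sn : sublinear (fun x : X => `|x|).
  by split=> [u v|t v t0]; [exact: ler_normD|rewrite normrZ ger0_norm].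
have [|f [fn fS]] := @Hahn_Banach_cone _ _ _ [set s | exists k t,
    [/\ K k, 0 <= t & s = (k - t *: x0, t * d)]] sn.
  split.
  - by exists 0, 0; split=> //; rewrite scale0r subr0 mul0r.
  - move=> _ _ [k [t [Kk t0 ->]]] [k' [t' [Kk' t0' ->]]].
    exists (k + k'), (t + t'); split; [exact: KD|exact: addr_ge0|].
    by rewrite scalerDl mulrDl opprD addrACA.
  - move=> a _ a0 [k [t [Kk t0 ->]]].
    exists (a *: k), (a * t); split; [exact: KZ|exact: mulr_ge0|].
    by rewrite /= scalerBr scalerA mulrA.
  - move=> _ [k [t [Kk + ->]]] /=; rewrite le0r => /orP[/eqP->|t0].
      by rewrite mul0r.
    have -> : k - t *: x0 = t *: (t^-1 *: k - x0).
      by rewrite scalerBr scalerA divff ?gt_eqF// scale1r.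
    rewrite normrZ gtr0_norm// ler_pM2l//.
    by apply/dK/KZ => //; rewrite invr_ge0 ltW.
exists f; split.
- apply/bounded_linear_continuous/linear_boundedP.
  near=> r => x; apply: (@le_trans _ _ `|x|).
    by rewrite ler_norml fn andbT lerNl -linearN (le_trans (fn _))// normrN.
  by rewrite ler_peMl//; near: r; exact: nbhs_pinfty_ge.
- move=> k Kk; apply: (fS (k, 0)); exists k, 0; split=> //.
  by rewrite scale0r subr0 mul0r.
- have := fS (- x0, d); rewrite /= linearN => h.
  rewrite -oppr_gt0; apply: lt_le_trans d0 (h _).
  by exists 0, 1; split=> //; rewrite scale1r mul1r sub0r.
Unshelve. all: by end_near. Qed.

(** The sum is twice the midpoint. *)
Lemma ordering_coneD (R : realType) (X : normedModType R) (K : set X) :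
  ordering_cone K -> forall x y, K x -> K y -> K (x + y).
Proof.
move=> [_ cK _ KZ _] x y Kx Ky.
have h : K (2^-1 *: x + (1 - 2^-1) *: y).
  have h0 : 0 <= 2^-1 :> R by lra.
  have h1 : 2^-1 <= 1 :> R by lra.
  exact: set_mem (cK x y (Itv01 h0 h1) (mem_set Kx) (mem_set Ky)).
have -> : x + y = 2 *: (2^-1 *: x + (1 - 2^-1) *: y).
  rewrite scalerDr !scalerA mulrBr mulr1 divff ?pnatr_eq0// scale1r.
  by rewrite -[2 - 1]/(1 + 1 - 1) addrK scale1r.
by apply: KZ h; rewrite ler0n.
Qed.

Lemma cone_le_po (R : realType) (X : normedModType R) (K : set X) :
  ordering_cone K -> partial_order (cone_le K).
Proof.
move=> oK; have [_ _ K0 _ Kanti] := oK; split.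
- by move=> a; rewrite /cone_le subrr.
- move=> b a c ab bc; rewrite /cone_le -(subrKA b).
  exact: (ordering_coneD oK).
- move=> a b ab ba; apply/esym/subr0_eq; apply: Kanti => //.
  by rewrite opprB.
Qed.

Lemma weak_continuous (R : realType) (X : normedModType R)
    (f : {linear X -> R^o}) :
  continuous f -> continuous (f : weak_space X -> R^o).
Proof.
move=> cf x.
have /cvg_sup/(_ (exist _ f cf)) h : nbhs x --> (x : weak_space X) by [].
apply: cvg_trans (cvg_app _ h) _.
exact: (@initial_continuous X R^o f x).
Qed.

(** By separation, a <= b iff f a <= f b for every continuous linear [f] that is
    nonnegative on [K], so both kinds of sections are intersections of weakly
    closed half-spaces. *)
Lemma weak_closed_sections (R : realType) (X : normedModType R) (K : set X)
    (u : X) : ordering_cone K ->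
  closed ([set x | cone_le K u x] : set (weak_space X)) /\
  closed ([set x | cone_le K x u] : set (weak_space X)).
Proof.
move=> oK; have [clK _ K0 KZ _] := oK.
pose D := [set f : {linear X -> R^o} |
  continuous f /\ forall k, K k -> 0 <= f k].
have leP a b : cone_le K a b <-> forall f, D f -> f a <= f b.
  split=> [Kab f [_ fK]|fab]; first by rewrite -subr_ge0 -linearB fK.
  apply: contrapT => /(cone_separation clK K0 (ordering_coneD oK) KZ).
  by move=> [f [cf fK]]; rewrite linearB subr_lt0 ltNge fab.
split.
  have -> : [set x | cone_le K u x] =
      \bigcap_(f in D) (f @^-1` [set t | f u <= t]).
    by apply/seteqP; split=> x /leP.
  apply: closed_bigI => f [cf _]; apply: preimage_closed; last exact: closed_ge.
  by move=> x _; exact: weak_continuous.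
have -> : [set x | cone_le K x u] =
    \bigcap_(f in D) (f @^-1` [set t | t <= f u]).
  by apply/seteqP; split=> x /leP.
apply: closed_bigI => f [cf _]; apply: preimage_closed; last exact: closed_le.
by move=> x _; exact: weak_continuous.
Qed.

(** * Chains in compact sets *)

(** The chain need not lie in [E].  This matters when [E] is a value of the
    set-valued map and the chain consists of ascending points outside it. *)
Definition chain_closed (P : Type) (le : P -> P -> Prop) (E : set P) :=
  forall B, B !=set0 -> total_on B le ->
    (forall b, B b -> exists2 e, E e & le b e) ->
    exists2 e, E e & forall b, B b -> le b e.

(** The sets of points of [C `&` Z] above [b], for [b] in the chain, generate a
    proper filter; its cluster point in [C] lies in every closed set of the
    filter. *)
Lemma compact_chain_closed (T : topologicalType) (le : T -> T -> Prop)
    (C Z : set T) :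
    (forall b a c, le a b -> le b c -> le a c) ->
    (forall b, closed [set x | le b x]) ->
    compact C -> closed Z -> chain_closed le (C `&` Z).
Proof.
move=> letr clle cptC clZ B [b0 Bb0] Btot BE.
pose F := filter_from B (fun b => (C `&` Z) `&` [set x | le b x]).
have FF : ProperFilter F.
  apply: filter_from_proper; last first.
    by move=> b /BE[e CZe be]; exists e.
  apply: filter_from_filter; first by exists b0.
  move=> b c Bb Bc; case: (Btot _ _ Bb Bc) => [bc|cb].
    by exists c => // x [CZx cx]; split; split=> //; exact: letr bc cx.
  by exists b => // x [CZx bx]; split; split=> //; exact: letr cb bx.
have [|e [Ce Fe]] := cptC F FF; first by exists b0 => // x [[]].
have cl W : closed W -> F W -> W e.
  by move=> clW FW; apply: clW; move: Fe; rewrite clusterE; exact.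
exists e; first by split=> //; apply: cl => //; exists b0 => // x [[]].
by move=> b Bb; apply: cl (clle b) _; exists b => // x [].
Qed.

(** A chain of pairs projects to a chain in each factor, so bounds are found
    factorwise, without any topology on the product. *)
Lemma chain_closedM (P Q : Type) (leP : P -> P -> Prop) (leQ : Q -> Q -> Prop)
    (E : set P) (E' : set Q) :
  chain_closed leP E -> chain_closed leQ E' ->
  chain_closed (prod_le leP leQ) (E `*` E').
Proof.
move=> cE cE' B [b0 Bb0] Btot BE.
have [|||e Ee eB] := cE (fst @` B).
- by exists b0.1; exists b0.
- move=> _ _ [b Bb <-] [c Bc <-].
  by case: (Btot _ _ Bb Bc) => -[? ?]; [left|right].
- by move=> _ [b Bb <-]; have [e [? ?] [? ?]] := BE b Bb; exists e.1.
have [|||e' Ee' eB'] := cE' (snd @` B).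
- by exists b0.2; exists b0.
- move=> _ _ [b Bb <-] [c Bc <-].
  by case: (Btot _ _ Bb Bc) => -[? ?]; [left|right].
- by move=> _ [b Bb <-]; have [e' [? ?] [? ?]] := BE b Bb; exists e'.2.
exists (e, e') => // b Bb; split; first by apply: eB; exists b.
by apply: eB'; exists b.
Qed.

Lemma prod_le_po (P Q : Type) (leP : P -> P -> Prop) (leQ : Q -> Q -> Prop) :
  partial_order leP -> partial_order leQ -> partial_order (prod_le leP leQ).
Proof.
move=> [Px Pt Pa] [Qx Qt Qa].
split=> [[a a']|[b b'] [a a'] [c c']|[a a'] [b b']].
- by split.
- move=> [/= ab ab'] [/= bc bc'].
  by split; [exact: Pt ab bc|exact: Qt ab' bc'].
- by move=> [/= ? ?] [/= ? ?]; congr (_, _); [exact: Pa|exact: Qa].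
Qed.

(** * Fixed points of increasing set-valued maps *)

Definition lower_bounds (P : Type) (le : P -> P -> Prop) (W : set P) :=
  [set x | forall w, W w -> le x w].

Section fixed_points.
Variables (P : Type) (le : P -> P -> Prop) (A : set P) (H : P -> set P).
Hypotheses (po : partial_order le)
  (Asup : forall W, chain_closed le (A `&` lower_bounds le W))
  (HA : forall p, A p -> H p `<=` A)
  (Hchain : forall p, A p -> chain_closed le (H p))
  (Hincr : order_increasing_upward le le A H).

Definition ascending := [set p | A p /\ exists2 q, H p q & le p q].

(** With [W] the set of upper bounds of [B], the set [lower_bounds le W]
    contains [B], and a bound of [B] inside it is the supremum [u] of [B].
    Leastness of [u] is what places it below the common bound of [B] in
    [H u]. *)
Lemma ascending_chain_ub B : B !=set0 -> B `<=` ascending -> total_on B le ->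
  exists2 u, ascending u & forall b, B b -> le b u.
Proof.
have [lexx letr _] := po; move=> B0 Basc Btot.
pose ubs := [set w | forall b, B b -> le b w].
have [b Bb|u [Au uW] Bu] := @Asup ubs B B0 Btot.
  by exists b => //; split; [exact: (Basc b Bb).1|move=> w; exact].
exists u => //; split=> //.
have [b Bb|q Hq Bq] := Hchain Au B0 Btot; last by exists q => //; exact: uW.
have [Ab [r Hr br]] := Basc b Bb.
by have [q Hq rq] := Hincr Ab Au (Bu b Bb) Hr; exists q => //; exact: letr rq.
Qed.

(** A maximal ascending point is a fixed point, and it is maximal among the
    fixed points since these are all ascending. *)
Lemma ascending_below_fixed p : ascending p ->
  exists2 s, maximal_in le [set s | A s /\ H s s] s & le p s.
Proof.
have [lexx letr leanti] := po; move=> ascp.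
have [s [[As [q Hq sq]] smax] ps] := Zorn_above po ascending_chain_ub ascp.
exists s => //; split; last first.
  by move=> t [At Ht]; apply: smax; split=> //; exists t.
split=> //; suff eq_sq : s = q by rewrite {2}eq_sq.
apply: contrapT => neq; apply: (smax q) => //; split.
  exact: (HA As).
exact: Hincr As (HA As Hq) sq Hq.
Qed.

(** The empty chain is bounded by any fixed point; a nonempty chain of fixed
    points has an ascending bound, which in turn lies below a fixed point. *)
Lemma increasing_fixed_points p : ascending p ->
  inductive_set le [set s | A s /\ H s s] /\
  exists s, maximal_in le [set s | A s /\ H s s] s.
Proof.
have [lexx letr _] := po; move=> ascp; split=> [B Bfix Btot|]; last first.
  by have [s] := ascending_below_fixed ascp; exists s.
have [B0|B0] := pselect (B !=set0); last first.
  have [s [fixs _] _] := ascending_below_fixed ascp.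
  by exists s => // b Bb; case: B0; exists b.
have [b Bb|u ascu Bu] := ascending_chain_ub B0 _ Btot.
  by have [Ab Hb] := Bfix b Bb; split=> //; exists b.
have [s [fixs _] us] := ascending_below_fixed ascu.
by exists s => // b Bb; exact: letr (Bu b Bb) us.
Qed.

End fixed_points.

(** * Reciprocal order-equilibria *)

(** Weakly closed order intervals make both kinds of sets weakly closed in [C].
    The first part serves for the values of phi and psi, the second one for the
    existence of suprema. *)
Lemma weakly_compact_chain_closed (R : realType) (X : normedModType R)
    (K C : set X) : ordering_cone K -> weakly_compact C ->
  (forall E, E `<=` C -> weakly_closed_in C E -> chain_closed (cone_le K) E) /\
  (forall W, chain_closed (cone_le K) (C `&` lower_bounds (cone_le K) W)).
Proof.
move=> oK wC; have [_ letr _] := cone_le_po oK.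
have main (Z : set (weak_space X)) :
    closed Z -> chain_closed (cone_le K) ((C : set (weak_space X)) `&` Z).
  apply: (@compact_chain_closed (weak_space X)) => // b.
  exact: (weak_closed_sections b oK).1.
split=> [E EC /closed_subspaceP[Z clZ ZE]|W].
  by rewrite -(setIidl EC) -ZE setIC; exact: main.
apply: main.
have -> : lower_bounds (cone_le K) W =
    \bigcap_(w in W) [set x | cone_le K x w] by [].
by apply: closed_bigI => w _; exact: (weak_closed_sections w oK).2.
Qed.

Lemma roep_solutionsE (X Y : Type) (disp : Order.disp_t) (U : porderType disp)
    (T : X -> Y -> U) (F : X -> set Y) (G : Y -> set X) (C : set X)
    (D : set Y) :
  roep_solutions T F G C D = [set s | (C `*` D) s /\
    (roep_psi T G s.2 `*` roep_phi T F s.1) s].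
Proof.
apply/seteqP; split=> -[x y] /=.
  move=> [Cx Dy Gx Fy opt]; split=> //; split; split=> //; split.
  - by exists x.
  - move=> _ [x' Gx' <-] [le ne]; have [nlt _] := opt _ _ Gx' Fy.
    by apply: nlt; rewrite lt_neqAle le andbT; exact/eqP.
  - by exists y.
  - move=> _ [y' Fy' <-] [le ne]; have [_ nlt] := opt _ _ Gx Fy'.
    by apply: nlt; rewrite lt_neqAle le andbT; exact/eqP.
move=> [[Cx Dy] [[Gx [_ xmax]] [Fy [_ ymin]]]]; split=> // x' y' Gx' Fy'.
split; rewrite lt_neqAle => /andP[/eqP ne le].
  by apply: (xmax (T x' y)); [exists x'|split].
by apply: (ymin (T x y')); [exists y'|split].
Qed.

Theorem theorem4p2 (R : realType) (X Y : completeNormedModType R)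
  (KX : set X) (KY : set Y) (hKX : ordering_cone KX) (hKY : ordering_cone KY)
  (disp : Order.disp_t) (U : porderType disp)
  (C : set X) (D : set Y) (C0 : C !=set0) (D0 : D !=set0)
  (Cwc : weakly_compact C) (Dwc : weakly_compact D)
  (T : X -> Y -> U) (F : X -> set Y) (G : Y -> set X)
  (hF : setvalued_map C D F) (hG : setvalued_map D C G)
  (hphi : setvalued_map C D (roep_phi T F))
  (hpsi : setvalued_map D C (roep_psi T G))
  (phi_incr : order_increasing_upward (cone_le KX) (cone_le KY) C
                (roep_phi T F))
  (psi_incr : order_increasing_upward (cone_le KY) (cone_le KX) D
                (roep_psi T G))
  (phi_closed : forall x, C x -> weakly_closed_in D (roep_phi T F x))
  (psi_closed : forall y, D y -> weakly_closed_in C (roep_psi T G y))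
  (hstart : exists x' y' u' z',
     [/\ C x' /\ D y', roep_phi T F x' u', roep_psi T G y' z',
         cone_le KX x' z' & cone_le KY y' u']) :
  [/\ roep_solutions T F G C D !=set0,
      inductive_set (prod_le (cone_le KX) (cone_le KY))
        (roep_solutions T F G C D)
    & exists s, maximal_in (prod_le (cone_le KX) (cone_le KY))
        (roep_solutions T F G C D) s].
Proof.
have [Xchain Xsup] := weakly_compact_chain_closed hKX Cwc.
have [Ychain Ysup] := weakly_compact_chain_closed hKY Dwc.
pose le := prod_le (cone_le KX) (cone_le KY).
pose H (p : X * Y) := roep_psi T G p.2 `*` roep_phi T F p.1.
have [x' [y' [u' [z' [[Cx Dy] phiu psiz xz yu]]]]] := hstart.
have [||p [Cp Dp]|p [Cp Dp]|p q r [Cp Dp] [Cq Dq] [pq1 pq2] [r1 r2]|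
     |ind [s smax]] :=
  @increasing_fixed_points (X * Y) le (C `*` D) H _ _ _ _ _ (x', y').
- exact: prod_le_po (cone_le_po hKX) (cone_le_po hKY).
- move=> W.
  have -> : (C `*` D) `&` lower_bounds le W =
      (C `&` lower_bounds (cone_le KX) (fst @` W)) `*`
      (D `&` lower_bounds (cone_le KY) (snd @` W)).
    apply/seteqP; split=> -[x y].
      move=> [[Cx1 Dy1] lb]; split; split=> // _ [w Ww <-];
      by have [] := lb w Ww.
    move=> [[Cx1 lbx] [Dy1 lby]]; split=> // w Ww.
    by split; [apply: lbx|apply: lby]; exists w.
  exact: chain_closedM.
- move=> q [psi_q phi_q].
  by split; [exact: (hpsi _ Dp).2 _ psi_q|exact: (hphi _ Cp).2 _ phi_q].
- apply: chain_closedM.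
    exact: Xchain (hpsi _ Dp).2 (psi_closed _ Dp).
  exact: Ychain (hphi _ Cp).2 (phi_closed _ Cp).
- have [r1' psi_r' r1r1'] := psi_incr _ _ _ Dp Dq pq2 r1.
  have [r2' phi_r' r2r2'] := phi_incr _ _ _ Cp Cq pq1 r2.
  by exists (r1', r2').
- by split=> //; exists (z', u').
by rewrite roep_solutionsE; split=> //; exists s => //; case: smax.
Qed.
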